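(* Let $r\ge0$. The identity functor $\mathrm{ESpSe}'_r\to\mathrm{ESpSe}_r$ is a right Bousfield localization which is not a Quillen equivalence.
   Context: $R$ is a commutative ring with unit. A bigraded module is a family $A=\{A^{p,n}\}_{p,n\in\mathbb Z}$ of $R$-modules. For $r\ge 0$, an $r$-bigraded complex is a bigraded module with $R$-linear maps $d_r\colon A^{p,n}\to A^{p-r,n+1-r}$, $d_r^2=0$; morphisms are bidegree-preserving $R$-linear maps commuting with $d_r$; $H(A)=\ker d_r/\operatorname{im} d_r$; a quasi-isomorphism is a morphism inducing an isomorphism on $H$. An extended spectral sequence $(X,\varphi)$ is a family of $r$-bigraded complexes $(X_r,d_r)$, $r\ge0$, with morphisms of bigraded modules $\varphi_{r+1}\colon X_{r+1}\to H(X_r)$ for $r\ge 0$ (characteristic maps). A morphism $f\colon X\to Y$ is a family of morphisms of $r$-bigraded complexes $f_r\colon X_r\to Y_r$, $r\ge 0$, with $\varphi^Y_{r+1}f_{r+1}=H(f_r)\varphi^X_{r+1}$. The category of extended spectral sequences is $\mathrm{ESpSe}$. $\mathrm{ESpSe}_r$ and $\mathrm{ESpSe}'_r$ are the model category structures on $\mathrm{ESpSe}$ whose fibrations are, in both cases, the maps $f$ with $f_i$ bidegreewise surjective for $0\le i\le r$; the weak equivalences of $\mathrm{ESpSe}_r$ are the maps $f$ such that $f_r$ is a quasi-isomorphism, and those of $\mathrm{ESpSe}'_r$ are the maps $f$ such that $f_r$ is a quasi-isomorphism and $f_i$ is an isomorphism for all $i>r$. The identity functor from a model category $M'$ to a model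 category $M$ with the same underlying category is a right Bousfield localization if $M$ and $M'$ have the same fibrations and every weak equivalence of $M'$ is a weak equivalence of $M$. *)

(* Defs.v *)
(* Library: MathComp, with classical reasoning from MathComp-Analysis
   (mathcomp.classical). *)
From HB Require Import structures.
From mathcomp Require Import all_boot all_order all_algebra.
From mathcomp Require Import boolp.

Set Implicit Arguments.
Unset Strict Implicit.
Unset Printing Implicit Defensive.

Import GRing.Theory.
Local Open Scope ring_scope.

(** * Categories and model categories *)

Record category := Category {
  obj :> Type;
  mor : obj -> obj -> Type;
  idm : forall X, mor X X;
  mcomp : forall X Y Z, mor Y Z -> mor X Y -> mor X Z;
  comp_idl : forall X Y (f : mor X Y), mcomp (idm Y) f = f;
  comp_idr : forall X Y (f : mor X Y), mcomp f (idm X) = f;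
  comp_assoc : forall X Y Z T (f : mor Z T) (g : mor Y Z) (h : mor X Y),
    mcomp f (mcomp g h) = mcomp (mcomp f g) h }.

Arguments mor {c} X Y.
Arguments idm {c} X.
Arguments mcomp {c X Y Z} f g.
Notation "f \oc g" := (mcomp f g) (at level 50, left associativity).

Record functor (C D : category) := Functor {
  fobj :> C -> D;
  fmap : forall X Y : C, mor X Y -> mor (fobj X) (fobj Y);
  fmap_id : forall X : C, fmap (idm X) = idm (fobj X);
  fmap_comp : forall (X Y Z : C) (f : mor Y Z) (g : mor X Y),
    fmap (f \oc g) = fmap f \oc fmap g }.

Arguments fmap {C D} _ {X Y} _.

Definition functor_id (C : category) : functor C C :=
  @Functor C C (fun X => X) (fun X Y f => f)
    (fun X => erefl) (fun X Y Z f g => erefl).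

Record adjunction (C D : category) (F : functor C D) (U : functor D C) :=
  Adjunction {
  adj : forall (X : C) (Y : D), mor (F X) Y -> mor X (U Y);
  adj_bij : forall X Y, bijective (@adj X Y);
  adj_nat : forall (X X' : C) (Y Y' : D)
      (a : mor X' X) (b : mor Y Y') (f : mor (F X) Y),
    adj (b \oc f \oc fmap F a) = fmap U b \oc adj f \oc a }.

Section CategoryNotions.
Variable C : category.
Implicit Types X Y Z A B : C.

Definition is_iso X Y (f : mor X Y) : Prop :=
  exists g : mor Y X, g \oc f = idm X /\ f \oc g = idm Y.

Definition is_initial X : Prop :=
  forall Y, exists f : mor X Y, forall g : mor X Y, g = f.

Definition is_terminal X : Prop :=
  forall Y, exists f : mor Y X, forall g : mor Y X, g = f.

Definition is_cone (J : category) (D : functor J C) (L : C)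
    (p : forall j : J, mor L (D j)) : Prop :=
  forall (i j : J) (u : mor i j), fmap D u \oc p i = p j.

Definition has_limit (J : category) (D : functor J C) : Prop :=
  exists (L : C) (p : forall j : J, mor L (D j)), is_cone p /\
    forall (X : C) (q : forall j : J, mor X (D j)), is_cone q ->
      exists2 h : mor X L, (forall j, p j \oc h = q j) &
        forall h' : mor X L, (forall j, p j \oc h' = q j) -> h' = h.

Definition is_cocone (J : category) (D : functor J C) (L : C)
    (p : forall j : J, mor (D j) L) : Prop :=
  forall (i j : J) (u : mor i j), p j \oc fmap D u = p i.

Definition has_colimit (J : category) (D : functor J C) : Prop :=
  exists (L : C) (p : forall j : J, mor (D j) L), is_cocone p /\
    forall (X : C) (q : forall j : J, mor (D j) X), is_cocone q ->
      exists2 h : mor L X, (forall j, h \oc p j = q j) &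
        forall h' : mor L X, (forall j, h' \oc p j = q j) -> h' = h.

Definition is_retract X Y X' Y' (f : mor X Y) (g : mor X' Y') : Prop :=
  exists (i : mor X X') (p : mor X' X) (j : mor Y Y') (q : mor Y' Y),
    [/\ p \oc i = idm X, q \oc j = idm Y,
        g \oc i = j \oc f & f \oc p = q \oc g].

Definition has_lifting A B X Y (i : mor A B) (p : mor X Y) : Prop :=
  forall (u : mor A X) (v : mor B Y), p \oc u = v \oc i ->
    exists h : mor B X, h \oc i = u /\ p \oc h = v.

Definition mor_class := forall X Y, mor X Y -> Prop.

Definition class_and (P Q : mor_class) : mor_class :=
  fun X Y f => P X Y f /\ Q X Y f.

Definition closed_retract (P : mor_class) : Prop :=
  forall X Y X' Y' (f : mor X Y) (g : mor X' Y'),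
    is_retract f g -> P X' Y' g -> P X Y f.

Definition two_out_of_three (P : mor_class) : Prop :=
  forall X Y Z (f : mor X Y) (g : mor Y Z),
    [/\ P X Y f -> P Y Z g -> P X Z (g \oc f),
        P X Y f -> P X Z (g \oc f) -> P Y Z g &
        P Y Z g -> P X Z (g \oc f) -> P X Y f].

Definition class_lifting (P Q : mor_class) : Prop :=
  forall A B X Y (i : mor A B) (p : mor X Y),
    P A B i -> Q X Y p -> has_lifting i p.

Definition class_factorization (P Q : mor_class) : Prop :=
  forall X Y (f : mor X Y), exists (Z : C) (i : mor X Z) (p : mor Z Y),
    [/\ P X Z i, Q Z Y p & f = p \oc i].

End CategoryNotions.

(* [finite_set] from the library would constrain the universe of [T]. *)
Definition finite_type (T : Type) : Prop :=
  exists (n : nat) (e : 'I_n -> T), forall x, exists k, e k = x.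

Definition finite_category (J : category) : Prop :=
  finite_type J /\ forall i j : J, finite_type (mor i j).

(* Quillen's axioms (CM1)-(CM5) for a closed model category: only finite limits
   and colimits are required, and factorizations need not be functorial. *)
Record model_structure (C : category) := ModelStructure {
  weq : mor_class C;
  fib : mor_class C;
  cof : mor_class C;
  model_lim : forall (J : category) (D : functor J C),
    finite_category J -> has_limit D;
  model_colim : forall (J : category) (D : functor J C),
    finite_category J -> has_colimit D;
  model_2of3 : two_out_of_three weq;
  model_retract :
    [/\ closed_retract weq, closed_retract fib & closed_retract cof];
  model_lift_cof : class_lifting cof (class_and fib weq);
  model_lift_fib : class_lifting (class_and cof weq) fib;
  model_fact_cof : class_factorization cof (class_and fib weq);
  model_fact_fib : class_factorization (class_and cof weq) fib }.

Arguments weq {C} _ {X Y} _.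
Arguments fib {C} _ {X Y} _.
Arguments cof {C} _ {X Y} _.

Section ModelNotions.
Variables (C : category) (M : model_structure C).

Definition cofibrant (X : C) : Prop :=
  exists (O : C) (f : mor O X), is_initial O /\ cof M f.

Definition fibrant (X : C) : Prop :=
  exists (T : C) (f : mor X T), is_terminal T /\ fib M f.

End ModelNotions.

Section QuillenEquivalence.
Variables (C D : category) (M : model_structure C) (N : model_structure D).
Variables (F : functor C D) (U : functor D C) (a : adjunction F U).

Definition quillen_adjunction : Prop :=
  (forall (X Y : C) (f : mor X Y), cof M f -> cof N (fmap F f)) /\
  (forall (X Y : D) (f : mor X Y), fib N f -> fib M (fmap U f)).

Definition quillen_equivalence_adj : Prop :=
  quillen_adjunction /\
  forall (X : C) (Y : D) (f : mor (F X) Y),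
    cofibrant M X -> fibrant N Y -> (weq N f <-> weq M (adj a f)).

End QuillenEquivalence.

Definition left_quillen_equivalence (C D : category) (M : model_structure C)
    (N : model_structure D) (F : functor C D) : Prop :=
  exists (U : functor D C) (a : adjunction F U), quillen_equivalence_adj M N a.

Definition right_quillen_equivalence (C D : category) (M : model_structure C)
    (N : model_structure D) (U : functor C D) : Prop :=
  exists (F : functor D C) (a : adjunction F U), quillen_equivalence_adj N M a.

(* The functor may sit on either side of the Quillen adjunction. *)
Definition quillen_equivalence (C D : category) (M : model_structure C)
    (N : model_structure D) (G : functor C D) : Prop :=
  left_quillen_equivalence M N G \/ right_quillen_equivalence M N G.

(* The identity functor from (C, M') to (C, M). *)
Definition right_bousfield_localization (C : category)
    (M' M : model_structure C) : Prop :=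
  (forall (X Y : C) (f : mor X Y), fib M' f <-> fib M f) /\
  (forall (X Y : C) (f : mor X Y), weq M' f -> weq M f).

(** * Quotient modules *)

Lemma linear_ext (R : pzRingType) (V W : lmodType R) (f g : {linear V -> W}) :
  f =1 g -> f = g.
Proof.
case: f g => [f [[f1] [f2]]] [g [[g1] [g2]]] /= /funext fg.
case: g / fg in g1 g2 *.
by rewrite (Prop_irrelevance f1 g1) (Prop_irrelevance f2 g2).
Qed.

Record submod_of (R : pzRingType) (V : lmodType R) := SubmodOf {
  in_submod :> V -> Prop;
  submod0 : in_submod 0;
  submodP : forall (a : R) u v,
    in_submod u -> in_submod v -> in_submod (a *: u + v) }.

Section QuotientModule.
Variables (R : pzRingType) (V : lmodType R) (B : submod_of V).

Definition submod_pred : V -> bool := fun x => `[< B x >].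

Lemma submod_pred_zmod : zmod_closed submod_pred.
Proof.
split=> [|x y /asboolP Bx /asboolP By]; first exact/asboolP/submod0.
by apply/asboolP; rewrite addrC -scaleN1r; apply: submodP.
Qed.

HB.instance Definition _ :=
  GRing.isZmodClosed.Build V submod_pred submod_pred_zmod.

Definition submod_zmod : zmodClosed V := GRing.ZmodClosed.clone V submod_pred _.

Definition quotmod : Type := Quotient.quot submod_zmod.
HB.instance Definition _ := GRing.Zmodule.on quotmod.
HB.instance Definition _ := Quotient.on quotmod.

Local Open Scope quotient_scope.

Definition quotpi (x : V) : quotmod := \pi_quotmod x.
Definition quotrepr (y : quotmod) : V := repr y.

Lemma quotreprK y : quotpi (quotrepr y) = y.
Proof. exact: reprK. Qed.

Lemma quotpi_eq x y : quotpi x = quotpi y <-> B (x - y).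
Proof.
split=> [/eqP|Bxy]; first by rewrite -Quotient.idealrBE => /asboolP.
by apply/eqP; rewrite -Quotient.idealrBE; apply/asboolP.
Qed.

Lemma quotpiD x y : quotpi (x + y) = quotpi x + quotpi y.
Proof. exact: (raddfD (\pi_quotmod)). Qed.

Lemma submodZ (a : R) x : B x -> B (a *: x).
Proof. by move=> Bx; rewrite -[_ *: _]addr0; apply: submodP => //; apply: submod0. Qed.

Definition quotscale (a : R) (y : quotmod) : quotmod :=
  quotpi (a *: quotrepr y).

Lemma quotscale_pi a x : quotscale a (quotpi x) = quotpi (a *: x).
Proof.
by apply/quotpi_eq; rewrite -scalerBr; apply/submodZ/quotpi_eq/quotreprK.
Qed.

Lemma quotscaleA a b y : quotscale a (quotscale b y) = quotscale (a * b) y.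
Proof. by rewrite -[y]quotreprK !quotscale_pi scalerA. Qed.

Lemma quotscale1 : left_id 1 quotscale.
Proof. by move=> y; rewrite -[y]quotreprK quotscale_pi scale1r. Qed.

Lemma quotscaleDr : right_distributive quotscale +%R.
Proof.
move=> a y z; rewrite -[y]quotreprK -[z]quotreprK -quotpiD !quotscale_pi.
by rewrite -quotpiD scalerDr.
Qed.

Lemma quotscaleDl y : {morph quotscale^~ y : a b / a + b}.
Proof. by move=> a b; rewrite -[y]quotreprK !quotscale_pi -quotpiD scalerDl. Qed.

HB.instance Definition _ := GRing.Zmodule_isLmodule.Build R quotmod
  quotscaleA quotscale1 quotscaleDr quotscaleDl.

Lemma quotpi_linear : linear quotpi.
Proof. by move=> a x y; rewrite quotpiD -quotscale_pi. Qed.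

HB.instance Definition _ := GRing.isLinear.Build R V quotmod _ quotpi
  quotpi_linear.

End QuotientModule.

(** * Bigraded modules and r-bigraded complexes *)

Section Bigraded.
Variable R : comNzRingType.

Definition bgmod := int -> int -> lmodType R.
Identity Coercion fun_of_bgmod : bgmod >-> Funclass.

Definition bghom (A B : bgmod) : Type :=
  forall p n : int, {linear A p n -> B p n}.
Identity Coercion fun_of_bghom : bghom >-> Funclass.

Lemma bghom_ext (A B : bgmod) (f g : bghom A B) :
  (forall p n x, f p n x = g p n x) -> f = g.
Proof. by move=> fg; do 2!(apply: functional_extensionality_dep => ?); apply: linear_ext. Qed.

Definition bgid (A : bgmod) : bghom A A := fun p n => idfun.

Definition bgcomp (A B C : bgmod) (f : bghom B C) (g : bghom A B) : bghom A C :=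
  fun p n => (f p n \o g p n).

Definition BgMod : category.
Proof.
by refine (@Category bgmod bghom bgid bgcomp _ _ _); move=> *; apply: bghom_ext.
Defined.

Variable r : nat.

Record rcomplex := RComplex {
  cmod :> bgmod;
  diff : forall p n : int, {linear cmod p n -> cmod (p - r%:Z) (n + 1 - r%:Z)};
  diffK : forall (p n : int) (x : cmod p n),
    diff (p - r%:Z) (n + 1 - r%:Z) (diff p n x) = 0 }.

Arguments diff : clear implicits.


Record rhom (A B : rcomplex) := RHom {
  rmap :> bghom A B;
  rmap_diff : forall (p n : int) (x : A p n),
    rmap (p - r%:Z) (n + 1 - r%:Z) (diff A p n x) = diff B p n (rmap p n x) }.

Lemma rhom_ext (A B : rcomplex) (f g : rhom A B) :
  (forall p n x, f p n x = g p n x) -> f = g.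
Proof.
case: f g => f f' [g g'] /= /bghom_ext fg; case: g / fg in g' *.
by rewrite (Prop_irrelevance f' g').
Qed.

Definition rid (A : rcomplex) : rhom A A :=
  @RHom A A (bgid A) (fun p n x => erefl).

Lemma rcomp_diff (A B C : rcomplex) (f : rhom B C) (g : rhom A B)
    (p n : int) (x : A p n) :
  bgcomp f g (p - r%:Z) (n + 1 - r%:Z) (diff A p n x) =
  diff C p n (bgcomp f g p n x).
Proof. by rewrite /bgcomp /= !rmap_diff. Qed.

Definition rcomp (A B C : rcomplex) (f : rhom B C) (g : rhom A B) : rhom A C :=
  RHom (rcomp_diff f g).

Definition RCpx : category.
Proof.
by refine (@Category rcomplex rhom rid rcomp _ _ _); move=> *; apply: rhom_ext.
Defined.

Section Homology.
Variables (A : rcomplex).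

(* The image of the differential; being an inductive family, it avoids
   transporting elements along equalities such as (p + r) - r = p. *)
Inductive boundary : forall p n : int, A p n -> Prop :=
  Boundary (p n : int) (x : A p n) :
    @boundary (p - r%:Z) (n + 1 - r%:Z) (diff A p n x).

Lemma boundary_inv (p n : int) (b : A (p - r%:Z) (n + 1 - r%:Z)) :
  boundary b <-> exists x : A p n, b = diff A p n x.
Proof.
split=> [|[x ->]]; last exact: Boundary.
suff gen (p1 n1 : int) (b1 : A p1 n1) : boundary b1 ->
    forall (ep : p1 = p - r%:Z) (en : n1 = n + 1 - r%:Z),
    exists x : A p n, ecast q (A q _) ep (ecast m (A _ m) en b1) = diff A p n x.
  by move=> /gen /(_ erefl erefl).
move=> {b} bd; case: p1 n1 b1 / bd => p1 n1 x ep en.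
have ep' : p1 = p by apply: addIr ep.
have en' : n1 = n by apply: (@addIr _ 1); apply: addIr en.
case: p / ep' ep => ep; case: n / en' en => en.
by exists x; rewrite (eq_irrelevance ep erefl) (eq_irrelevance en erefl).
Qed.

Lemma bidegree_shift (P : int -> int -> Prop) :
  (forall p n : int, P (p - r%:Z) (n + 1 - r%:Z)) -> forall p n, P p n.
Proof.
by move=> HP p n; have := HP (p + r%:Z) (n + r%:Z - 1); rewrite addrK subrK addrK.
Qed.

Lemma boundary0 (p n : int) : @boundary p n 0.
Proof.
move: p n; apply: bidegree_shift => p n.
by rewrite boundary_inv; exists 0; rewrite linear0.
Qed.

Lemma boundaryP (p n : int) (a : R) (b c : A p n) :
  boundary b -> boundary c -> boundary (a *: b + c).
Proof.
move: p n b c; apply: bidegree_shift => p n b c.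
rewrite !boundary_inv => -[x ->] [y ->].
by exists (a *: x + y); rewrite linearP.
Qed.

Variables (p n : int).

Definition cycle_pred : A p n -> bool := fun x => diff A p n x == 0.

Lemma cycle_submod : submod_closed cycle_pred.
Proof.
split=> [|a x y]; rewrite !unfold_in /cycle_pred ?linear0 // => /eqP dx /eqP dy.
by rewrite linearP dx dy scaler0 addr0.
Qed.

HB.instance Definition _ :=
  GRing.isSubmodClosed.Build R (A p n) cycle_pred
    (GRing.submod_closed_semi cycle_submod).

Record cycle := Cycle { cycle_val : A p n; _ : cycle_val \in cycle_pred }.

HB.instance Definition _ := [isSub for cycle_val].
HB.instance Definition _ := [Choice of cycle by <:].
HB.instance Definition _ := [SubChoice_isSubLmodule of cycle by <:].

Lemma cycleP (z : cycle) : diff A p n (cycle_val z) = 0.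
Proof. by case: z => x /= /eqP. Qed.

Definition mk_cycle (x : A p n) (dx : diff A p n x = 0) : cycle :=
  @Cycle x (introT eqP dx).

Definition cycle_boundary : submod_of cycle :=
  @SubmodOf R cycle (fun z => boundary (cycle_val z)) (boundary0 p n)
    (fun a u v => @boundaryP p n a (cycle_val u) (cycle_val v)).

Definition homology_at : lmodType R := quotmod cycle_boundary.

End Homology.

Definition homology (A : rcomplex) : bgmod := fun p n => homology_at A p n.

Definition hclass (A : rcomplex) (p n : int) : cycle A p n -> homology A p n :=
  @quotpi R (cycle A p n) (cycle_boundary A p n).

Section HomologyMap.
Variables (A B : rcomplex) (f : rhom A B) (p n : int).

Lemma map_cycle_subproof (z : cycle A p n) : diff B p n (f p n (cycle_val z)) = 0.
Proof. by rewrite -rmap_diff cycleP linear0. Qed.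

Definition map_cycle (z : cycle A p n) : cycle B p n :=
  mk_cycle (map_cycle_subproof z).

Lemma map_cycle_linear : linear map_cycle.
Proof. by move=> a x y; apply: val_inj; rewrite /= !linearP. Qed.

HB.instance Definition _ := GRing.isLinear.Build R (cycle A p n) (cycle B p n) _
  map_cycle map_cycle_linear.

Definition Hfun (y : homology A p n) : homology B p n :=
  hclass (map_cycle (quotrepr y)).

Lemma map_boundary (b : A p n) : boundary b -> boundary (f p n b).
Proof. by case=> p1 n1 x; rewrite rmap_diff; apply: Boundary. Qed.

Lemma HfunE (z : cycle A p n) : Hfun (hclass z) = hclass (map_cycle z).
Proof.
have [+ _] := @quotpi_eq R _ (cycle_boundary A p n) (quotrepr (hclass z)) z.
move=> /(_ (quotreprK _)) /map_boundary bz; apply/quotpi_eq.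
by move: bz; rewrite /= !linearB.
Qed.

Lemma Hfun_linear : linear Hfun.
Proof.
move=> a x y; rewrite -[x]quotreprK -[y]quotreprK -linearP.
by rewrite !HfunE /hclass !linearP.
Qed.

HB.instance Definition _ := GRing.isLinear.Build R
  (homology A p n) (homology B p n) _ Hfun Hfun_linear.

End HomologyMap.

Definition Hmap (A B : rcomplex) (f : rhom A B) : bghom (homology A) (homology B) :=
  fun p n => @Hfun A B f p n.

Lemma Hmap_id (A : rcomplex) : Hmap (rid A) = bgid (homology A).
Proof.
apply: bghom_ext => p n x; rewrite -[x]quotreprK; move: (quotrepr x) => z.
have e : map_cycle (rid A) z = z by apply: val_inj.
by rewrite [LHS]HfunE e.
Qed.

Lemma Hmap_comp (A B C : rcomplex) (f : rhom B C) (g : rhom A B) :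
  Hmap (rcomp f g) = bgcomp (Hmap f) (Hmap g).
Proof.
apply: bghom_ext => p n x; rewrite -[x]quotreprK; move: (quotrepr x) => z.
have e : map_cycle (rcomp f g) z = map_cycle f (map_cycle g z).
  exact: val_inj.
by rewrite [LHS]HfunE e /bgcomp /Hmap /= -[quotpi _ z]/(hclass z) !HfunE.
Qed.

Definition quasi_iso (A B : rcomplex) (f : rhom A B) : Prop :=
  is_iso (Hmap f : @mor BgMod (homology A) (homology B)).

Definition rcpx_iso (A B : rcomplex) (f : rhom A B) : Prop :=
  is_iso (f : @mor RCpx A B).

Definition bisurjective (A B : bgmod) (f : bghom A B) : Prop :=
  forall (p n : int) (y : B p n), exists x : A p n, f p n x = y.

End Bigraded.

(** * Extended spectral sequences *)

Section ExtendedSpectralSequences.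
Variable R : comNzRingType.

(* The characteristic maps are only morphisms of bigraded modules: no
   compatibility with differentials is required.  [charm i] is the map from
   page i.+1 to the homology of page i. *)
Record espse := ESpectral {
  page :> forall i : nat, rcomplex R i;
  charm : forall i : nat, bghom (page i.+1) (homology (page i)) }.

Record espse_hom (X Y : espse) := ESpectralHom {
  espse_map :> forall i : nat, rhom (X i) (Y i);
  espse_map_charm : forall i : nat,
    bgcomp (charm Y i) (espse_map i.+1) = bgcomp (Hmap (espse_map i)) (charm X i) }.

Lemma espse_hom_ext (X Y : espse) (f g : espse_hom X Y) :
  (forall i p n x, f i p n x = g i p n x) -> f = g.
Proof.
case: f g => f f' [g g'] /= fg.
have {}fg : f = g.
  by apply: functional_extensionality_dep => i; apply: rhom_ext => p n x; apply: fg.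
by case: g / fg in g' *; rewrite (Prop_irrelevance f' g').
Qed.

Lemma espse_id_charm (X : espse) (i : nat) :
  bgcomp (charm X i) (rid (X i.+1)) = bgcomp (Hmap (rid (X i))) (charm X i).
Proof. by rewrite Hmap_id; apply: bghom_ext. Qed.

Definition espse_id (X : espse) : espse_hom X X :=
  @ESpectralHom X X (fun i => rid (X i)) (espse_id_charm X).

Lemma espse_comp_charm (X Y Z : espse) (f : espse_hom Y Z) (g : espse_hom X Y)
    (i : nat) :
  bgcomp (charm Z i) (rcomp (f i.+1) (g i.+1)) =
  bgcomp (Hmap (rcomp (f i) (g i))) (charm X i).
Proof.
rewrite Hmap_comp; apply: bghom_ext => p n x.
have fE y := congr1 (fun h : bghom _ _ => h p n y) (espse_map_charm f i).
have gE y := congr1 (fun h : bghom _ _ => h p n y) (espse_map_charm g i).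
by move: (fE (g i.+1 p n x)) (gE x) => /= -> /= ->.
Qed.

Definition espse_comp (X Y Z : espse) (f : espse_hom Y Z) (g : espse_hom X Y) :
    espse_hom X Z :=
  @ESpectralHom X Z (fun i => rcomp (f i) (g i)) (espse_comp_charm f g).

Definition ESpSe : category.
Proof.
by refine (@Category espse espse_hom espse_id espse_comp _ _ _);
  move=> *; apply: espse_hom_ext.
Defined.

Variable r : nat.

Definition ESpSe_fib (X Y : espse) (f : espse_hom X Y) : Prop :=
  forall i : nat, (i <= r)%N -> bisurjective (f i).

Definition ESpSe_weq (X Y : espse) (f : espse_hom X Y) : Prop :=
  quasi_iso (f r).

Definition ESpSe_weq' (X Y : espse) (f : espse_hom X Y) : Prop :=
  quasi_iso (f r) /\ forall i : nat, (r < i)%N -> rcpx_iso (f i).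

(* A model structure is determined by its fibrations and weak equivalences. *)
Definition is_ESpSe_model (M : model_structure ESpSe) : Prop :=
  (forall (X Y : ESpSe) (f : mor X Y), fib M f <-> ESpSe_fib f) /\
  (forall (X Y : ESpSe) (f : mor X Y), weq M f <-> ESpSe_weq f).

Definition is_ESpSe_model' (M : model_structure ESpSe) : Prop :=
  (forall (X Y : ESpSe) (f : mor X Y), fib M f <-> ESpSe_fib f) /\
  (forall (X Y : ESpSe) (f : mor X Y), weq M f <-> ESpSe_weq' f).

End ExtendedSpectralSequences.

(* Main.v *)
Require Import Defs.
From mathcomp Require Import all_boot all_order all_algebra.

Set Implicit Arguments.
Unset Strict Implicit.
Unset Printing Implicit Defensive.

Import GRing.Theory.
Local Open Scope ring_scope.

(** The localization property is read off from the two descriptions of the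
    classes of maps, the weak equivalences of [ESpSe'_r] satisfying one condition
    more.

    The failure of the Quillen equivalence is witnessed by the map [0 -> Y],
    where [Y] ([next_page]) vanishes on all pages except page [r + 1].  Its
    component on page [r] is a map of zero complexes, so it is a weak equivalence
    of [ESpSe_r]; on page [r + 1] it is not an isomorphism, so it is not one of
    [ESpSe'_r].  The object [0] is cofibrant in any model structure on [ESpSe],
    because identities are cofibrations ([cof_id]), and every object is fibrant
    ([espse_fibrant]).

    An adjoint of the identity on either side need not be the identity on the
    nose, so the derived condition compares [0 -> Y] with its transpose.  If the
    identity is the left adjoint, the right adjoint [U] comes with natural
    isomorphisms [Y -> U Y] ([adj_unit_iso]), and the transpose [0 -> U Y] being
    an isomorphism on page [r + 1] would make [U Y], hence [Y], vanish there.  If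
    the identity is the right adjoint, the left adjoint [F] sends [0] to an
    object whose only endomorphism is the identity, that is to a zero object, and
    an isomorphism from it on page [r + 1] would again make [Y] vanish there. *)

(** If [idm X = p \oc i], then [idm X] is a retract of [i], through [i] and [p]. *)
Lemma cof_id (C : category) (M : model_structure C) (X : C) : cof M (idm X).
Proof.
have [Z [i [p [cof_i _ pi1]]]] := model_fact_cof M (idm X).
have [_ _ cof_retract] := model_retract M.
apply: (cof_retract _ _ _ _ _ i) => //.
by exists (idm X), (idm X), i, p; split; rewrite ?comp_idl ?comp_idr.
Qed.

Lemma initial_cofibrant (C : category) (M : model_structure C) (X : C) :
  is_initial X -> cofibrant M X.
Proof. by move=> initX; exists X, (idm X); split=> //; apply: cof_id. Qed.

(** By naturality every transpose is a composite with the transpose of an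
    identity; the inverse is the map whose transpose is the identity of [U Y]. *)
Lemma adj_unit_iso (C : category) (U : functor C C)
    (a : adjunction (functor_id C) U) (Y : C) :
  is_iso (adj a (idm Y : mor (functor_id C Y) Y)).
Proof.
have adjE X (f : mor X Y) :
    adj a (f : mor (functor_id C X) Y) =
    adj a (idm Y : mor (functor_id C Y) Y) \oc f.
  have := adj_nat a f (idm Y) (idm Y : mor (functor_id C Y) Y).
  by rewrite fmap_id !comp_idl.
have [adjV _ adjVK] := adj_bij a (U Y) Y.
exists (adjV (idm (U Y))); split; last by rewrite -adjE adjVK.
apply: (bij_inj (adj_bij a Y Y)).
by rewrite adjE comp_assoc -adjE adjVK comp_idl.
Qed.

Section ZeroPages.
Variable R : comNzRingType.

Definition bgzero (A : bgmod R) : Prop := forall (p n : int) (x : A p n), x = 0.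

Lemma bgzero_is_iso (A B : bgmod R) (f : bghom A B) :
  bgzero A -> bgzero B -> is_iso (f : @mor (BgMod R) A B).
Proof.
move=> A0 B0.
exists (fun p n => \0 : {linear B p n -> A p n}).
by split; apply: bghom_ext => p n x; rewrite [LHS](A0, B0) [RHS](A0, B0).
Qed.

Lemma homology_bgzero (r : nat) (A : rcomplex R r) :
  bgzero A -> bgzero (homology A).
Proof.
move=> A0 p n x; rewrite -[x]quotreprK.
suff -> : quotrepr x = 0 by apply: linear0.
by apply: val_inj; apply: A0.
Qed.

Lemma rcpx_iso_bgzero (r : nat) (A B : rcomplex R r) (f : rhom A B) :
  rcpx_iso f -> bgzero A -> bgzero B.
Proof.
move=> [g [_ fg]] A0 p n y.
have /= <- := congr1 (fun h : rhom B B => h p n y) fg.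
by rewrite /bgcomp /= (A0 _ _ (g p n y)) linear0.
Qed.

Lemma espse_iso_page (X Y : espse R) (f : espse_hom X Y) (i : nat) :
  is_iso (f : @mor (ESpSe R) X Y) -> rcpx_iso (f i).
Proof.
move=> [g [gf fg]]; exists (g i).
by split; [have := congr1 (fun h : espse_hom X X => h i) gf
          |have := congr1 (fun h : espse_hom Y Y => h i) fg].
Qed.

Definition row_rcomplex (i k : nat) : rcomplex R i :=
  @RComplex R i (fun _ _ => 'rV[R]_k) (fun _ _ => \0) (fun _ _ _ => erefl).

(** Constant in the bidegree, so that a page can be made zero or nonzero without
    transport along equalities of bidegrees. *)
Definition row_espse (m : nat -> nat) : espse R :=
  @ESpectral R (fun i => row_rcomplex i (m i)) (fun _ _ _ => \0).

Lemma row_espse_bgzero (m : nat -> nat) (i : nat) :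
  m i = 0%N -> bgzero (row_espse m i).
Proof.
by move=> mi p n /=; rewrite mi => x; apply: thinmx0.
Qed.

Definition null_rhom (i : nat) (A B : rcomplex R i) : rhom A B :=
  @RHom R i A B (fun _ _ => \0) (fun p n x => esym (linear0 _)).

Lemma null_hom_charm (X Y : espse R) (i : nat) :
  bgcomp (charm Y i) (null_rhom (X i.+1) (Y i.+1)) =
  bgcomp (Hmap (null_rhom (X i) (Y i))) (charm X i).
Proof.
apply: bghom_ext => p n x; rewrite /bgcomp /= linear0 /Hfun.
set z := map_cycle _ _.
have -> : z = 0 by apply: val_inj.
by rewrite /hclass linear0.
Qed.

Definition null_hom (X Y : espse R) : espse_hom X Y :=
  ESpectralHom (null_hom_charm X Y).

Lemma bgzero_initial (X : ESpSe R) :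
  (forall i, bgzero (page X i)) -> is_initial X.
Proof.
move=> X0 Y; exists (null_hom X Y) => g; apply: espse_hom_ext => i p n x.
by rewrite (X0 i p n x) !linear0.
Qed.

Lemma bgzero_terminal (X : ESpSe R) :
  (forall i, bgzero (page X i)) -> is_terminal X.
Proof.
move=> X0 Y; exists (null_hom Y X) => g; apply: espse_hom_ext => i p n x.
exact: X0.
Qed.

Definition espse0 : ESpSe R := row_espse (fun=> 0%N).

Lemma espse0_bgzero (i : nat) : bgzero (page espse0 i).
Proof. exact: row_espse_bgzero. Qed.

Lemma espse_fibrant (r : nat) (M : model_structure (ESpSe R)) (Y : ESpSe R) :
  (forall (X Y : ESpSe R) (f : mor X Y), fib M f <-> ESpSe_fib r f) ->
  fibrant M Y.
Proof.
move=> fibE; exists espse0, (null_hom Y espse0).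
split; first exact/bgzero_terminal/espse0_bgzero.
by apply/fibE => i _ p n y; exists 0; rewrite (espse0_bgzero y) linear0.
Qed.

(** The identity of [X] coincides with its null endomorphism. *)
Lemma unique_endo_bgzero (X : ESpSe R) :
  (forall f g : mor X X, f = g) -> forall i, bgzero (page X i).
Proof.
move=> endoX i p n x.
exact: (congr1 (fun h : espse_hom X X => h i p n x)
               (endoX (idm X) (null_hom X X))).
Qed.

Definition next_page (r : nat) : ESpSe R :=
  row_espse (fun i => nat_of_bool (i == r.+1)).

Lemma next_page_not_bgzero (r : nat) : ~ bgzero (page (next_page r) r.+1).
Proof.
rewrite /next_page /row_espse /= eqxx => /(_ 0 0 (const_mx 1)) /matrixP.
by move=> /(_ 0 0); rewrite !mxE => /eqP; rewrite oner_eq0.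
Qed.

Lemma null_next_page_weq (r : nat) (f : espse_hom espse0 (next_page r)) :
  ESpSe_weq r f.
Proof.
apply: bgzero_is_iso; apply: homology_bgzero; first exact: espse0_bgzero.
by apply: row_espse_bgzero; rewrite ltn_eqF.
Qed.

Section Witness.
Variables (r : nat) (M' M : model_structure (ESpSe R)).
Hypotheses (hM : is_ESpSe_model r M) (hM' : is_ESpSe_model' r M').

Lemma weq'_next_page (X Y : ESpSe R) (f : mor X Y) :
  weq M' f -> bgzero (page X r.+1) -> bgzero (page Y r.+1).
Proof. by move=> /hM'.2 [_ isof]; apply: rcpx_iso_bgzero; apply: isof. Qed.

Lemma id_not_left_quillen_equivalence :
  ~ left_quillen_equivalence M' M (functor_id (ESpSe R)).
Proof.
move=> [U [a [_ weqE]]]; apply: (@next_page_not_bgzero r).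
pose f : mor (functor_id (ESpSe R) espse0) (next_page r) := null_hom _ _.
have weq_adjf : weq M' (adj a f).
  apply/weqE; last exact/hM.2/null_next_page_weq.
    exact/initial_cofibrant/bgzero_initial/espse0_bgzero.
  exact: espse_fibrant hM.1.
have U0 := weq'_next_page weq_adjf (@espse0_bgzero _).
have [g [gK Kg]] := adj_unit_iso a (next_page r).
have isog : is_iso g by exists (adj a (idm _)).
exact: rcpx_iso_bgzero (espse_iso_page r.+1 isog) U0.
Qed.

Lemma id_not_right_quillen_equivalence :
  ~ right_quillen_equivalence M' M (functor_id (ESpSe R)).
Proof.
move=> [F [a [_ weqE]]]; apply: (@next_page_not_bgzero r).
have init0 := bgzero_initial espse0_bgzero.
have F0 : forall i, bgzero (page (F espse0) i).
  apply: unique_endo_bgzero => f g; apply: (bij_inj (adj_bij a _ _)).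
  by have [h hE] := init0 (F espse0); rewrite (hE (adj a f)) (hE (adj a g)).
pose f : mor (F espse0) (next_page r) := null_hom _ _.
suff weqf : weq M' f by apply: weq'_next_page weqf (F0 _).
apply/weqE; last exact/hM.2/null_next_page_weq.
  exact: initial_cofibrant.
exact: espse_fibrant hM'.1.
Qed.

End Witness.
End ZeroPages.

Theorem proposition7p4p3 (R : comNzRingType) (r : nat)
    (ESpSe_r ESpSe'_r : model_structure (ESpSe R))
    (hr : is_ESpSe_model r ESpSe_r) (hr' : is_ESpSe_model' r ESpSe'_r) :
  right_bousfield_localization ESpSe'_r ESpSe_r /\
  ~ quillen_equivalence ESpSe'_r ESpSe_r (functor_id (ESpSe R)).
Proof.
split; last first.
  by case; [exact: id_not_left_quillen_equivalence hr hr'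
           |exact: id_not_right_quillen_equivalence hr hr'].
have [fibE weqE] := hr; have [fibE' weqE'] := hr'.
split=> X Y f; first by apply: (iff_trans (fibE' _ _ f)); apply: iff_sym.
by move=> /weqE' [weqf _]; apply/weqE.
Qed.
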